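(* Let $0<\alpha\le 1$ and let $\gamma_1,\gamma_2\in\mathbb{R}$ satisfy $0\le\gamma_1$, $0\le\gamma_2$, $\alpha+\gamma_1\le 1$, $\alpha+\gamma_1+\gamma_2\le 2$, and in addition $$\gamma_2<1,\qquad 1<\alpha+\gamma_1+\gamma_2 .$$ Let $D^{\alpha,(\gamma_1,\gamma_2)}_{2L}:X^1_{2L}\to L_1(0,1)$ be the 2nd level fractional derivative of order $\alpha$ and type $(\gamma_1,\gamma_2)$, and let $$(P^\alpha_{2L}f)(x)=f(x)-(I^{\alpha}D^{\alpha,(\gamma_1,\gamma_2)}_{2L}f)(x)$$ be its projector. Then for every $f\in X^1_{2L}$, $$(P^\alpha_{2L}f)(x)=p_1\,x^{\alpha+\gamma_1-1}+p_2\,x^{\alpha+\gamma_1+\gamma_2-2},$$ where $$p_1=\frac{1}{\Gamma(\alpha+\gamma_1)}\Big(I^{\gamma_2}\,\frac{d}{dx}\,I^{2-\alpha-\gamma_1-\gamma_2}f\Big)(0),\qquad p_2=\frac{1}{\Gamma(\alpha+\gamma_1+\gamma_2-1)}\Big(I^{2-\alpha-\gamma_1-\gamma_2}f\Big)(0).$$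
   Context: Functions in $L_1(0,1)$ are identified when equal almost everywhere; equalities between them (including the formula for $P^\alpha_{2L}f$) are understood in $L_1(0,1)$, i.e. for a.e. $x\in[0,1]$. For $\alpha\ge 0$ and $f\in L_1(0,1)$, the Riemann-Liouville fractional integral is $$(I^\alpha f)(x)=\frac{1}{\Gamma(\alpha)}\int_0^x (x-t)^{\alpha-1}f(t)\,dt\quad(\alpha>0),\qquad (I^0f)(x)=f(x).$$ $\mathrm{AC}([0,1])$ is the space of absolutely continuous functions on $[0,1]$: $f\in\mathrm{AC}([0,1])$ iff there is $\phi\in L_1(0,1)$ with $f(x)=f(0)+\int_0^x\phi(t)\,dt$ for $x\in[0,1]$. For such $f$ the first order derivative is defined by $\frac{df}{dx}:=\phi\in L_1(0,1)$. For an element $h$ of $L_1(0,1)$, ''$h\in\mathrm{AC}([0,1])$'' means that $h$ has an absolutely continuous representative, and then $h(0)$ denotes the value of this representative at $0$. The 2nd level fractional derivative of order $\alpha$ and type $(\gamma_1,\gamma_2)$ is the operator $D^{\alpha,(\gamma_1,\gamma_2)}_{2L}:X^1_{2L}\to L_1(0,1)$, $$(D^{\alpha,(\gamma_1,\gamma_2)}_{2L} f)(x)=\Big(I^{\gamma_1}\,\frac{d}{dx}\,I^{\gamma_2}\,\frac{d}{dx}\,I^{2-\alpha-\gamma_1-\gamma_2}f\Big)(x),$$ with domain $$X^1_{2L}=\Big\{f\in L_1(0,1):\ I^{2-\alpha-\gamma_1-\gamma_2}f\in\mathrm{AC}([0,1])\ \text{and}\ I^{\gamma_2}\frac{d}{dx}I^{2-\alpha-\gamma_1-\gamma_2}f\in\mathrm{AC}([0,1])\Big\}.$$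 *)

(* Defs.v *)
From HB Require Import structures.
From mathcomp Require Import all_boot all_order all_algebra.
From mathcomp Require Import all_classical all_reals all_analysis.

Set Implicit Arguments.
Unset Strict Implicit.
Unset Printing Implicit Defensive.

Import Order.TTheory GRing.Theory Num.Theory.
Import numFieldNormedType.Exports.

Local Open Scope classical_set_scope.
Local Open Scope ring_scope.

(* Elements of L_1(0,1) are represented by functions R -> R, of which only the
   a.e.-class on [0, 1] matters; equality in L_1(0,1) is eq01. *)
Section FractionalCalculus.
Context {R : realType}.
Implicit Types (a alpha gamma : R) (f g h F phi : R -> R).

Local Notation mu := (@lebesgue_measure R).

Definition L1_01 : set (R -> R) :=
  [set f | mu.-integrable `[0, 1]%classic (EFin \o f)].

Definition eq01 f g : Prop := ae_eq mu `[0, 1]%classic f g.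

Definition Gamma a : R :=
  \int[mu]_(t in `]0, +oo[) (t `^ (a - 1) * expR (- t)).

(* Meaningful for 0 <= a and f in L_1(0,1); for 0 < a < 1 the integral may
   diverge on a null set of x, where the value is immaterial. *)
Definition fracI a f : R -> R := fun x =>
  if a == 0 then f x
  else (Gamma a)^-1 * \int[mu]_(t in `[0, x]) ((x - t) `^ (a - 1) * f t).

Definition is_density F phi : Prop :=
  L1_01 phi /\
  forall x : R, x \in `[0, 1] -> F x = F 0 + \int[mu]_(t in `[0, x]) phi t.

Definition AC01 : set (R -> R) := [set F | exists phi, is_density F phi].

Definition AC_reps h : set (R -> R) := [set F | AC01 F /\ eq01 h F].

Definition in_AC h : Prop := AC_reps h !=set0.

(* The absolutely continuous representative of h (unique on [0, 1]) when
   in_AC h holds, and a junk value otherwise. *)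
Definition AC_rep h : R -> R := xget (fun=> 0) (AC_reps h).

Definition ddx h : R -> R := xget (fun=> 0) (is_density (AC_rep h)).

Definition X1_2L alpha gamma1 gamma2 : set (R -> R) :=
  [set f | [/\ L1_01 f,
    in_AC (fracI (2 - alpha - gamma1 - gamma2) f) &
    in_AC (fracI gamma2 (ddx (fracI (2 - alpha - gamma1 - gamma2) f)))]].

Definition D_2L alpha gamma1 gamma2 f : R -> R :=
  fracI gamma1
    (ddx (fracI gamma2 (ddx (fracI (2 - alpha - gamma1 - gamma2) f)))).

Definition P_2L alpha gamma1 gamma2 f : R -> R := fun x =>
  f x - fracI alpha (D_2L alpha gamma1 gamma2 f) x.

End FractionalCalculus.

(* Main.v *)
(** On [[0, 1]] the integral [I^a f] is, up to the factor [1 / Gamma a], the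
    convolution on the line of [t^(a-1)], cut off to [(0, 1]], with [f] extended
    by zero; the semigroup law thus reduces to a.e. associativity of convolution
    in [L_1] and to the Beta integral.  Put [s = alpha + gamma1],
    [b = 2 - alpha - gamma1 - gamma2], [c = 1 - b], and write [F] and [G] for the
    absolutely continuous representatives in the domain, with derivatives [phi1]
    and [phi2].  Then, a.e.,
      [I^1 f = I^c F = F(0) I^c 1 + I^c I^1 phi1]
    and, since [I^1 phi1 = I^(1-gamma2) I^gamma2 phi1] and [c + 1 - gamma2 = s],
      [I^c I^1 phi1 = I^s G = G(0) I^s 1 + I^s I^1 phi2].
    As [I^a 1 = I^1 (x^(a-1) / Gamma a)], everything on the right is [I^1] of an
    explicit function, and [I^1] is injective on [L_1]; finally
    [I^s phi2 = I^alpha D f].  All orders added by the semigroup law sum to at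
    most 1. *)

Require Import Defs.
From HB Require Import structures.
From mathcomp Require Import all_boot all_order all_algebra.
From mathcomp Require Import all_classical all_reals all_analysis.
From mathcomp Require Import measurable_realfun lra.

Set Implicit Arguments.
Unset Strict Implicit.
Unset Printing Implicit Defensive.

Import Order.TTheory GRing.Theory Num.Theory.
Import numFieldNormedType.Exports.

Local Open Scope classical_set_scope.
Local Open Scope ring_scope.

(** * Affine changes of variable for Lebesgue integrals *)

Section LebesgueAffine.
Context {R : realType}.
Local Notation mu := (@lebesgue_measure R).
Implicit Types (c d : R).

Lemma measurable_affine c d : measurable_fun [set: R] (fun x : R => c * x + d).
Proof. by apply: measurable_funD => //; exact: measurable_funM. Qed.

Local Open Scope ereal_scope.

(** The scaled pushforward of [mu] under the affine map agrees with [mu] on half-open intervals, so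
    uniqueness of Lebesgue measure applies. *)
Lemma lebesgue_measure_affine c d (A : set R) : (0 < c)%R -> measurable A ->
  c%:E * mu ((fun x => c * x + d)%R @^-1` A) = mu A.
Proof.
move=> c0 mA.
pose phi : R -> measurableTypeR R := (fun x => c * x + d)%R.
have mphi : measurable_fun [set: R] phi by exact: measurable_affine.
pose c' := NngNum (ltW c0).
pose phi' : {mfun R >-> measurableTypeR R} :=
  HB.pack phi (isMeasurableFun.Build _ _ _ _ phi mphi).
have := @lebesgue_measure_unique R (mscale c' (pushforward mu phi')) _ A mA.
move=> ->; first by [].
move=> _ [[a b]] _ <-; rewrite /mscale/= /pushforward/=.
rewrite [X in _ = _ * lebesgue_measure X](_ : _ =
    `]((a - d) / c)%R, ((b - d) / c)%R]%classic); last first.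
  by apply/seteqP; split=> x /=; rewrite /phi !in_itv/= ltr_pdivrMr//
    ler_pdivlMr// ltrBlDr lerBrDr (mulrC x).
rewrite !lebesgue_measure_itv/= !lte_fin ltr_pM2r ?invr_gt0// ltrD2r.
case: ifPn => _; last by rewrite mule0.
by rewrite -!EFinD -EFinM -mulrBl mulrC divfK ?gt_eqF//; congr EFin; lra.
Qed.

Lemma ge0_integral_affine c d (f : R -> \bar R) : (0 < c)%R ->
  measurable_fun setT f -> (forall x, 0 <= f x) ->
  \int[mu]_x f x = c%:E * \int[mu]_x f (c * x + d)%R.
Proof.
move=> c0 mf f0.
pose phi : R -> measurableTypeR R := (fun x => c * x + d)%R.
have mphi : measurable_fun [set: R] phi by exact: measurable_affine.
pose phi' : {mfun R >-> measurableTypeR R} :=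
  HB.pack phi (isMeasurableFun.Build _ _ _ _ phi mphi).
rewrite (eq_measure_integral
    (mscale (NngNum (ltW c0)) (pushforward mu phi'))); last first.
  by move=> A mA _; exact/esym/lebesgue_measure_affine.
rewrite ge0_integral_mscale//; congr (_ * _).
by rewrite ge0_integral_pushforward.
Qed.

Lemma ge0_integral_opp (f : R -> \bar R) :
  measurable_fun setT f -> (forall x, 0 <= f x) ->
  \int[mu]_x f x = \int[mu]_x f (- x)%R.
Proof.
move=> mf f0.
rewrite (eq_measure_integral
    (pushforward mu (-%R : R -> measurableTypeR R))); last first.
  by move=> A mA _; exact/esym/lebesgue_measureN.
by rewrite ge0_integral_pushforward.
Qed.

Lemma ge0_integral_shift d (f : R -> \bar R) :
  measurable_fun setT f -> (forall x, 0 <= f x) ->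
  \int[mu]_x f (x + d)%R = \int[mu]_x f x.
Proof.
move=> mf f0; rewrite (ge0_integral_affine d ltr01 mf f0) mul1e.
by apply: eq_integral => x _; rewrite mul1r.
Qed.

Lemma ge0_integral_reflect d (f : R -> \bar R) :
  measurable_fun setT f -> (forall x, 0 <= f x) ->
  \int[mu]_x f (d - x)%R = \int[mu]_x f x.
Proof.
move=> mf f0; rewrite -(ge0_integral_shift d mf f0) [RHS]ge0_integral_opp//.
- by apply: eq_integral => x _; rewrite addrC.
- by apply: (measurableT_comp mf); exact: measurable_funD.
Qed.

(** Here and in [integral_reflect], positive and negative parts are transported separately.
    Convergence plays no part in this, which is why [convol_sym] holds at every point and not just
    almost everywhere. *)
Lemma integral_shift d (f : R -> \bar R) : measurable_fun setT f ->
  \int[mu]_x f (x + d)%R = \int[mu]_x f x.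
Proof.
move=> mf; rewrite [RHS]integralE -(ge0_integral_shift d (measurable_funepos mf))//.
rewrite -(ge0_integral_shift d (measurable_funeneg mf))// [LHS]integralE.
under eq_integral do rewrite funepos_comp.
by under [X in _ - X = _]eq_integral do rewrite funeneg_comp.
Qed.

Lemma integral_reflect d (f : R -> \bar R) : measurable_fun setT f ->
  \int[mu]_x f (d - x)%R = \int[mu]_x f x.
Proof.
move=> mf; rewrite [RHS]integralE -(ge0_integral_reflect d (measurable_funepos mf))//.
rewrite -(ge0_integral_reflect d (measurable_funeneg mf))// [LHS]integralE.
under eq_integral do rewrite funepos_comp.
by under [X in _ - X = _]eq_integral do rewrite funeneg_comp.
Qed.

End LebesgueAffine.

(** * Homogeneity of the real-valued integral *)

Section RintegralScaling.
Context d (T : measurableType d) {R : realType} (mu : {measure set T -> \bar R}).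

(* [Rintegral] has the junk value 0 on a measurable function that is not
   integrable, so both sides vanish there. *)
Lemma RintegralZl_measurable (D : set T) (f : T -> R) (r : R) : measurable D ->
  measurable_fun D f ->
  \int[mu]_(x in D) (r * f x) = r * \int[mu]_(x in D) f x.
Proof.
move=> mD mf; have [->|r0] := eqVneq r 0.
  by under eq_Rintegral do rewrite mul0r; rewrite mul0r Rintegral_cst// mul0r.
have nonint (g : T -> R) : measurable_fun D g ->
    ~ mu.-integrable D (EFin \o g) -> \int[mu]_(x in D) g x = 0.
  move=> mg ig; rewrite /Rintegral.
  have : (\int[mu]_(x in D) (g x)%:E)%E \isn't a fin_num.
    rewrite -integral_fin_num_abs//; apply/negP => ig'; apply: ig.
    by apply/integrableP; split=> //; exact/measurable_EFinP.
  by rewrite fin_numE negb_and !negbK => /orP[]/eqP ->.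
have [intf|intf] := pselect (mu.-integrable D (EFin \o f)).
  exact: RintegralZl.
rewrite !nonint ?mulr0//; first exact: measurable_funM.
move=> /(integrableZl mD r^-1) irf; apply: intf.
by apply: eq_integrable irf => // x _; rewrite /= -EFinM mulKf.
Qed.

End RintegralScaling.

(** Registered by the hints below, so that [filterS] and [filterS2] can combine statements holding
    almost everywhere. *)
Lemma lebesgue_ae_filter (R : realType) :
  Filter (almost_everywhere (@lebesgue_measure R)).
Proof. exact: (ae_filter_ringOfSetsType lebesgue_measure). Qed.
#[local] Hint Extern 0 (Filter (nbhs (almost_everywhere (@lebesgue_measure _)))) =>
  exact: lebesgue_ae_filter : typeclass_instances.
#[local] Hint Extern 0 (Filter (almost_everywhere (@lebesgue_measure _))) =>
  exact: lebesgue_ae_filter : typeclass_instances.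

(** * Convolution *)

Section Convolution.
Context {R : realType}.
Local Notation mu := (@lebesgue_measure R).
Implicit Types (f g h : R -> R) (x : R).

(** For measurable arguments the default value 0 is taken where the integrand is not integrable;
    when both are in L_1, [ae_integrable_convol] confines this to a null set. *)
Definition convol g h x : R := \int[mu]_t (g (x - t) * h t).

Local Notation L1 f := (mu.-integrable [set: R] (EFin \o f)).

Lemma L1_measurable f : L1 f -> measurable_fun [set: R] f.
Proof. by move=> /measurable_int/measurable_EFinP. Qed.

Lemma L1_norm f : L1 f -> L1 (fun x => `|f x|).
Proof. exact: integrable_norm. Qed.

Lemma measurable_convol_integrand2 g h :
  measurable_fun setT g -> measurable_fun setT h ->
  measurable_fun [set: R * R] (fun p => g (p.1 - p.2) * h p.2).
Proof.
move=> mg mh; apply: measurable_funM.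
  by apply: (measurableT_comp mg); exact: measurable_funB.
by apply: (measurableT_comp mh).
Qed.

Lemma measurable_convol_integrand g h x :
  measurable_fun setT g -> measurable_fun setT h ->
  measurable_fun [set: R] (fun t => g (x - t) * h t).
Proof.
move=> mg mh; apply: measurable_funM => //.
by apply: (measurableT_comp mg); exact: measurable_funB.
Qed.

(** Tonelli, followed by translation invariance of the inner integral. *)
Lemma ge0_integral_convol (g h : R -> \bar R) :
  measurable_fun setT g -> measurable_fun setT h ->
  (forall x, 0 <= g x)%E -> (forall x, 0 <= h x)%E ->
  (\int[mu]_x \int[mu]_t (g (x - t)%R * h t) =
   \int[mu]_x g x * \int[mu]_x h x)%E.
Proof.
move=> mg mh g0 h0.
pose F (p : R * R) := (g (p.1 - p.2)%R * h p.2)%E.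
have mF : measurable_fun setT F.
  apply: emeasurable_funM; last exact: measurableT_comp.
  by apply: (measurableT_comp mg); exact: measurable_funB.
have F0 p : (0 <= F p)%E by rewrite mule_ge0.
rewrite [LHS](fubini_tonelli (m1 := mu) (m2 := mu) F mF F0) /F/=.
rewrite -ge0_integralZl//; last exact: integral_ge0.
apply: eq_integral => t _.
under eq_integral do rewrite muleC.
rewrite ge0_integralZl//; last first.
  by apply: (measurableT_comp mg); exact: measurable_funB.
by rewrite (ge0_integral_shift (- t)) // muleC.
Qed.

(** The iterated integral of the absolute value is the product of the two L_1 norms. Fubini then
    yields the a.e. existence, measurability and integrability of the convolution. *)
Lemma integrable_convol2 g h : L1 g -> L1 h ->
  (mu \x mu)%E.-integrable [set: R * R]
    (fun p => (g (p.1 - p.2) * h p.2)%:E).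
Proof.
move=> ig ih; have mg := L1_measurable ig; have mh := L1_measurable ih.
apply/integrable12ltyP.
  by apply/measurable_EFinP; exact: measurable_convol_integrand2.
under eq_integral do under eq_integral do rewrite /= normrM EFinM.
rewrite (@ge0_integral_convol (fun x => `|g x|%:E) (fun x => `|h x|%:E))//=.
- rewrite -(fineK (integrable_fin_num measurableT (L1_norm ig))).
  by rewrite -(fineK (integrable_fin_num measurableT (L1_norm ih))) -EFinM ltry.
- by apply/measurable_EFinP; exact: measurableT_comp.
- by apply/measurable_EFinP; exact: measurableT_comp.
Qed.

Lemma ae_integrable_convol g h : L1 g -> L1 h ->
  \forall x \ae mu, L1 (fun t => g (x - t) * h t).
Proof. by move=> ig ih; exact: (ae_integrable1 (integrable_convol2 ig ih)). Qed.

Lemma ae_EFin_convol g h : L1 g -> L1 h ->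
  \forall x \ae mu, (\int[mu]_t (g (x - t) * h t)%:E)%E = (convol g h x)%:E.
Proof.
move=> ig ih; apply: filterS (ae_integrable_convol ig ih) => x ix.
by rewrite /convol /Rintegral fineK//; exact: integrable_fin_num.
Qed.

Lemma measurable_convol g h : L1 g -> L1 h -> measurable_fun setT (convol g h).
Proof.
move=> ig ih.
apply: (@measurableT_comp _ _ _ _ _ _ fine); first exact: fine_measurable.
exact: measurable_fubini_F (integrable_convol2 ig ih).
Qed.

Lemma integrable_convol g h : L1 g -> L1 h -> L1 (convol g h).
Proof.
move=> ig ih; have iF := integrable_fubini_F (integrable_convol2 ig ih).
apply/integrableP; split; first by apply/measurable_EFinP; exact: measurable_convol.
move/integrableP : iF => [mF]; apply: le_lt_trans.
rewrite le_eqVlt; apply/orP; left; apply/eqP; apply: ae_eq_integral => //.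
- by apply/measurableT_comp => //; apply/measurable_EFinP; exact: measurable_convol.
- exact: measurableT_comp.
- by apply: filterS (ae_EFin_convol ig ih) => x E _; rewrite /comp -E.
Qed.

Lemma convol_sym g h x : measurable_fun setT g -> measurable_fun setT h ->
  convol g h x = convol h g x.
Proof.
move=> mg mh; rewrite /convol /Rintegral; congr fine.
rewrite -(integral_reflect x) /=.
  by apply: eq_integral => t _; rewrite mulrC subKr.
by apply/measurable_EFinP; exact: measurable_convol_integrand.
Qed.

Lemma convol_ae_eqr g h h' x :
  measurable_fun setT g -> measurable_fun setT h -> measurable_fun setT h' ->
  h = h' %[ae mu] -> convol g h x = convol g h' x.
Proof.
move=> mg mh mh' hh'; rewrite /convol /Rintegral; congr fine.
apply: ae_eq_integral => //.
- by apply/measurable_EFinP; exact: measurable_convol_integrand.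
- by apply/measurable_EFinP; exact: measurable_convol_integrand.
- by apply: filterS hh' => t /= ->.
Qed.

Lemma convol_ae_eql g g' h x :
  measurable_fun setT g -> measurable_fun setT g' -> measurable_fun setT h ->
  g = g' %[ae mu] -> convol g h x = convol g' h x.
Proof.
by move=> mg mg' mh gg'; rewrite convol_sym// (convol_ae_eqr _ mh mg mg' gg') convol_sym.
Qed.

(** The real inner integrals agree with the extended ones wherever the section is integrable, that
    is almost everywhere, and this suffices under the outer integral. *)
Lemma Rintegral_Fubini (F : R -> R -> R) :
  (mu \x mu)%E.-integrable [set: R * R] (fun p => (F p.1 p.2)%:E) ->
  \int[mu]_x \int[mu]_y F x y = \int[mu]_y \int[mu]_x F x y.
Proof.
move=> iF.
have H1 : (\int[mu]_x (\int[mu]_y F x y)%:E = \int[mu]_x \int[mu]_y (F x y)%:E)%E.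
  apply: ae_eq_integral => //.
  - apply/measurable_EFinP.
    apply: (@measurableT_comp _ _ _ _ _ _ fine); first exact: fine_measurable.
    exact: measurable_fubini_F iF.
  - exact: measurable_fubini_F iF.
  - apply: filterS (ae_integrable1 iF) => x ix _.
    by rewrite /Rintegral fineK//; exact: integrable_fin_num ix.
have H2 : (\int[mu]_y (\int[mu]_x F x y)%:E = \int[mu]_y \int[mu]_x (F x y)%:E)%E.
  apply: ae_eq_integral => //.
  - apply/measurable_EFinP.
    apply: (@measurableT_comp _ _ _ _ _ _ fine); first exact: fine_measurable.
    exact: measurable_fubini_G iF.
  - exact: measurable_fubini_G iF.
  - apply: filterS (ae_integrable2 iF) => x ix _.
    by rewrite /Rintegral fineK//; exact: integrable_fin_num ix.
exact: (congr1 fine (etrans H1 (etrans (Fubini iF) (esym H2)))).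
Qed.

(** Multiplicativity of total mass; applied to [powexp], it evaluates the Beta integral. *)
Lemma Rintegral_convol g h : L1 g -> L1 h ->
  \int[mu]_x convol g h x = \int[mu]_x g x * \int[mu]_x h x.
Proof.
move=> ig ih; have mg := L1_measurable ig.
rewrite (Rintegral_Fubini (integrable_convol2 ig ih)).
rewrite -RintegralZl_measurable//; last exact: L1_measurable.
apply: eq_Rintegral => t _.
under eq_Rintegral do rewrite mulrC.
rewrite RintegralZl_measurable//; last first.
  by apply: (measurableT_comp mg); exact: measurable_funB.
rewrite mulrC; congr (_ * _); rewrite /Rintegral; congr fine.
by apply: (integral_shift (- t) (f := EFin \o g)); exact/measurable_EFinP.
Qed.

(** Fubini for g(x - t) h(t - u) f(u) in (t, u), at each x where the convolution of |g| with that of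
    |h| and |f| converges; almost every x is of this kind. *)
Lemma convolA g h f : L1 g -> L1 h -> L1 f ->
  \forall x \ae mu, convol g (convol h f) x = convol (convol g h) f x.
Proof.
move=> ig ih jf.
have mg := L1_measurable ig; have mh := L1_measurable ih.
have mf := L1_measurable jf.
have iH := integrable_convol (L1_norm ih) (L1_norm jf).
apply: filterS (ae_integrable_convol (L1_norm ig) iH) => x ix.
pose F t u := g (x - t) * (h (t - u) * f u).
have iF : (mu \x mu)%E.-integrable [set: R * R] (fun p => (F p.1 p.2)%:E).
  have mF : measurable_fun [set: R * R] (fun p => F p.1 p.2).
    apply: measurable_funM; last exact: measurable_convol_integrand2.
    by apply: (measurableT_comp mg); exact: measurable_funB.
  apply/integrable12ltyP; first exact/measurable_EFinP.
  move/integrableP : ix => [mi]; apply: le_lt_trans.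
  rewrite le_eqVlt; apply/orP; left; apply/eqP; apply: ae_eq_integral => //.
  - apply: (measurable_fun_fubini_tonelli_F (m2 := mu) (fun p => `|(F p.1 p.2)%:E|%E)) => //=.
    by apply/measurable_EFinP; exact: measurableT_comp.
  - exact: measurableT_comp.
  apply: filterS (ae_EFin_convol (L1_norm ih) (L1_norm jf)) => t ft _.
  rewrite /= normrM normr_id EFinM.
  have -> : (`|convol (fun x => `|h x|) (fun x => `|f x|) t|%:E =
      \int[mu]_u (`|h (t - u)| * `|f u|)%:E)%E.
    by rewrite ft ger0_norm//; apply: Rintegral_ge0 => u _; rewrite mulr_ge0.
  rewrite -ge0_integralZl//.
  - by apply: eq_integral => u _; rewrite /F -EFinM !normrM.
  - apply/measurable_EFinP; apply: (measurable_convol_integrand (g := fun x => `|h x|)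
      (h := fun x => `|f x|)); exact: measurableT_comp.
transitivity (\int[mu]_t \int[mu]_u F t u).
  apply: eq_Rintegral => t _; rewrite -RintegralZl_measurable//.
  exact: measurable_convol_integrand.
rewrite Rintegral_Fubini//; apply: eq_Rintegral => u _.
(* Replacing t by t - u in the convolution at x - u gives the inner integral left by Fubini. *)
have -> : convol g h (x - u) = \int[mu]_t (g (x - t) * h (t - u)).
  rewrite /convol /Rintegral; congr fine.
  rewrite -[LHS](integral_shift (- u)).
    by apply: eq_integral => t _ /=; congr (g _ * _)%:E; lra.
  by apply/measurable_EFinP; exact: measurable_convol_integrand.
rewrite mulrC -RintegralZl_measurable//.
  by apply: eq_Rintegral => t _; rewrite /F mulrA mulrC.
apply: measurable_funM.
  by apply: (measurableT_comp mg); exact: measurable_funB.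
by apply: (measurableT_comp mh); exact: measurable_funB.
Qed.

End Convolution.

(** * Gamma function and Beta integral *)

Section GammaBeta.
Context {R : realType}.
Local Notation mu := (@lebesgue_measure R).
Implicit Types (a b c e t x : R).
Local Notation L1 f := (mu.-integrable [set: R] (EFin \o f)).

(* The convolution of two such kernels is the expected one only on [x <= 1], which
   suffices against functions supported in [[0, 1]]. *)
Definition pow01 a : R -> R := (fun t => t `^ (a - 1)) \_ `]0, 1].
(** The unnormalised Gamma density. Its total mass is [Gamma a], and the family is stable under
    convolution up to constants, see [convol_powexp]. *)
Definition powexp a : R -> R :=
  (fun t => t `^ (a - 1) * expR (- t)) \_ `]0, +oo[.

Lemma pow01E a t : 0 < t <= 1 -> pow01 a t = t `^ (a - 1).
Proof. by move=> t01; rewrite /pow01 patchE mem_set//= in_itv. Qed.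

Lemma pow01_out a t : ~~ (0 < t <= 1) -> pow01 a t = 0.
Proof.
by move=> t01; rewrite /pow01 patchE memNset//= in_itv/=; exact/negP.
Qed.

Lemma pow01_le0 a t : t <= 0 -> pow01 a t = 0.
Proof. by move=> t0; apply: pow01_out; rewrite negb_and -leNgt t0. Qed.

Lemma powexpE a t : 0 < t -> powexp a t = t `^ (a - 1) * expR (- t).
Proof. by move=> t0; rewrite /powexp patchE mem_set//= in_itv/= t0. Qed.

Lemma powexp_out a t : t <= 0 -> powexp a t = 0.
Proof.
by move=> t0; rewrite /powexp patchE memNset//= in_itv/= andbT ltNge t0.
Qed.

Lemma pow01_ge0 a t : 0 <= pow01 a t.
Proof. by rewrite /pow01 patchE; case: ifP => // _; exact: powR_ge0. Qed.

Lemma powexp_ge0 a t : 0 <= powexp a t.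
Proof.
by rewrite /powexp patchE; case: ifP => // _; rewrite mulr_ge0 ?powR_ge0 ?expR_ge0.
Qed.

Lemma measurable_pow01 a : measurable_fun setT (pow01 a).
Proof.
apply/(measurable_restrictT _ _).1 => //.
exact: measurable_funTS (measurable_powR _).
Qed.

Lemma measurable_powexp a : measurable_fun setT (powexp a).
Proof.
apply/(measurable_restrictT _ _).1 => //; apply: measurable_funM.
  exact: measurable_funTS (measurable_powR _).
by apply: measurable_funTS; apply: measurableT_comp => //; exact: measurable_expR.
Qed.

(** Uses the primitive t^a / a; the bound is uniform in [e], ready for the limit at 0. *)
Lemma integral_powR_le a e : 0 < a -> 0 < e < 1 ->
  (\int[mu]_(t in `[e, 1%R]) (t `^ (a - 1))%:E <= a^-1%:E)%E.
Proof.
move=> a0 /andP[e0 e1].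
have cpow p : {within `[e, 1], continuous (fun t : R => t `^ p)}.
  apply: derivable_within_continuous => t; rewrite in_itv/= => /andP[et _].
  by apply: derivable_powR; rewrite in_itv/= andbT (lt_le_trans e0).
rewrite (@continuous_FTC2 _ _ (fun t => a^-1 * t `^ a) e 1)//=.
- by rewrite powR1 mulr1 -EFinB lee_fin lerBlDr lerDl mulr_ge0 ?powR_ge0 ?invr_ge0 ?ltW.
- have d t : 0 < t -> derivable (fun t => a^-1 * t `^ a) t 1.
    move=> t0; apply: derivableM => //.
    by apply: derivable_powR; rewrite in_itv/= andbT.
  have c t : 0 < t -> {for t, continuous (fun t => a^-1 * t `^ a)}.
    by move=> t0; apply: differentiable_continuous; exact/derivable1_diffP/d.
  split.
  + by move=> t; rewrite in_itv/= => /andP[et _]; apply: d; exact: lt_trans et.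
  + by apply/cvg_at_right_filter; exact: c.
  + by apply/cvg_at_left_filter; exact: c.
- move=> t; rewrite in_itv/= => /andP[et _]; have t0 := lt_trans e0 et.
  rewrite derive1Ml//; last by apply: derivable_powR; rewrite in_itv/= andbT.
  by rewrite powR_derive1 ?in_itv/= ?andbT// mulrA mulVf ?mul1r// gt_eqF.
Qed.

Lemma integrable_pow01 a : 0 < a -> L1 (pow01 a).
Proof.
move=> a0; apply/integrableP; split.
  by apply/measurable_EFinP; exact: measurable_pow01.
apply: (@le_lt_trans _ _ a^-1%:E); last exact: ltry.
under eq_integral do rewrite /= ger0_norm ?pow01_ge0//.
have -> : (\int[mu]_t (pow01 a t)%:E = \int[mu]_(t in `]0%R, 1%R]) (t `^ (a - 1))%:E)%E.
  rewrite [RHS]integral_mkcond; apply: eq_integral => t _.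
  by rewrite /pow01 restrict_EFin.
(* These intervals increase to []0, 1]]. Starting at 1/2 keeps the left endpoint strictly below 1,
   as [integral_powR_le] requires. *)
pose F n : set R := `[n.+2%:R^-1, 1]%classic.
have -> : `]0%R, 1%R]%classic = \bigcup_n F n.
  apply/seteqP; split=> [t|t [n _]]; rewrite /F/= !in_itv/=.
    move=> /andP[t0 t1]; exists (Num.truncn t^-1) => //=; rewrite in_itv/= t1 andbT.
    rewrite -[leRHS]invrK lef_pV2 ?posrE ?invr_gt0//.
    apply/ltW/(lt_trans (truncnS_gt _)); by rewrite ltr_nat.
  by move=> /andP[nt ->]; rewrite andbT (lt_le_trans _ nt).
apply: cvge_le; last first.
  apply: ge0_nondecreasing_set_cvg_integral.
  - apply/nondecreasing_seqP => n; rewrite subsetEset.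
    by apply: subset_itvr; rewrite bnd_simp lef_pV2 ?posrE// ler_nat.
  - by move=> n; exact: measurable_itv.
  - move=> n; apply/measurable_EFinP.
    exact: measurable_funTS (measurable_powR _).
  - by move=> n t _; rewrite lee_fin powR_ge0.
apply: nearW => n; apply: integral_powR_le => //.
by rewrite invr_gt0 ltr0n/= invf_lt1// ltr1n.
Unshelve. exact: eventually_filter.
Qed.

(** Dominated by [pow01 a] up to 1 and by the exponential density beyond, where a <= 1 gives t^(a-1)
    <= 1. *)
Lemma integrable_powexp a : 0 < a <= 1 -> L1 (powexp a).
Proof.
move=> /andP[a0 a1].
have i2 := integrableD measurableT (integrable_pow01 a0)
  (integrable_exponential_pdf (ltr01 : 0 < 1 :> R)).
apply: le_integrable i2 => //.
  by apply/measurable_EFinP; exact: measurable_powexp.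
move=> t _; rewrite /= lee_fin ger0_norm ?powexp_ge0// ger0_norm; last first.
  by rewrite addr_ge0 ?pow01_ge0 ?exponential_pdf_ge0.
have [t0|t0] := leP t 0.
  by rewrite powexp_out// addr_ge0 ?pow01_ge0 ?exponential_pdf_ge0.
rewrite powexpE//; have [t1|t1] := leP t 1.
  rewrite pow01E ?t0// -[leLHS]addr0 lerD ?exponential_pdf_ge0//.
  by rewrite ler_piMr ?powR_ge0// expR_le1 oppr_le0 ltW.
rewrite exponential_pdfE ?(ltW t0)// mul1r mulN1r -[leLHS]add0r lerD ?pow01_ge0//.
rewrite ler_piMl ?expR_ge0// -[leRHS](powRr0 t).
by apply: ler_powR; rewrite ?(ltW t1)// subr_le0.
Qed.

Lemma GammaE a : Gamma a = \int[mu]_t powexp a t.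
Proof. by rewrite /Gamma Rintegral_mkcond. Qed.

Lemma Gamma1 : Gamma 1 = 1 :> R.
Proof.
rewrite GammaE /Rintegral -[RHS]/(fine 1%E) -(integral_exponential_pdf (ltr01 : 0 < 1 :> R)).
congr fine; apply: ae_eq_integral => //.
- by apply/measurable_EFinP; exact: measurable_powexp.
- by apply/measurable_EFinP; exact: measurable_exponential_pdf.
(* The two densities differ only at 0, which [powexp] leaves out of its support. *)
- exists [set 0]; split=> //; first exact: lebesgue_measure_set1.
  move=> t /=; apply: contra_notP => /eqP t0 _; congr EFin.
  have [t1|t1] := ltP 0 t.
    by rewrite powexpE// exponential_pdfE ?(ltW t1)// subrr powRr0 mulN1r.
  rewrite powexp_out// /exponential_pdf patchE memNset//= in_itv/= andbT.
  by apply/negP; rewrite -ltNge lt_neqAle t0.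
Qed.

(** On []0, 1]] the integrand is at least exp(-1), since a <= 1. *)
Lemma Gamma_gt0 a : 0 < a <= 1 -> 0 < Gamma a.
Proof.
move=> /[dup] a01 /andP[a0 a1]; rewrite GammaE.
have i1 : L1 ((fun=> expR (- 1 : R)) \_ `]0, 1]).
  rewrite -restrict_EFin; apply: (integrable_mkcond _ _).1 => //.
  apply: measurable_bounded_integrable => //=.
    by rewrite lebesgue_measure_itv/= lte_fin ltr01 ltry.
  exact: bounded_cst.
apply: (@lt_le_trans _ _ (\int[mu]_t ((fun=> expR (- 1 : R)) \_ `]0, 1]) t)).
  rewrite -Rintegral_mkcond Rintegral_cst//= lebesgue_measure_itv/= lte_fin ltr01/=.
  by rewrite subr0 mulr1 expR_gt0.
apply: le_Rintegral => //; first exact: integrable_powexp.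
move=> t _; rewrite patchE; case: ifPn => [|_]; last exact: powexp_ge0.
rewrite inE/= in_itv/= => /andP[t0 t1]; rewrite powexpE//.
rewrite -[leLHS]mul1r ler_pM ?expR_ge0// ?ler_expR ?lerN2//.
by rewrite -[leLHS](powRr0 t) ger_powR ?t0// subr_le0.
Qed.

Lemma ge0_Rintegral_scale c (f : R -> R) : 0 < c -> measurable_fun setT f ->
  (forall x, 0 <= f x) -> \int[mu]_x f x = c * \int[mu]_x f (c * x).
Proof.
move=> c0 mf f0; rewrite -RintegralZl_measurable//; last first.
  by apply: (measurableT_comp mf); exact: measurable_funM.
rewrite /Rintegral; congr fine.
rewrite (ge0_integral_affine 0 c0) //; last exact/measurable_EFinP.
under [X in (_ * X)%E]eq_integral do rewrite addr0.
rewrite -ge0_integralZl_EFin ?ltW//.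
  by move=> x _; rewrite lee_fin.
by apply/measurable_EFinP; apply: (measurableT_comp mf); exact: measurable_funM.
Qed.

(** The substitution t = x u. The kernels stay abstract so that both [pow01] and [powexp] can be
    inserted. *)
Lemma convol_homogeneous a b c (g h : R -> R) x : 0 < x ->
  measurable_fun setT g -> measurable_fun setT h ->
  (forall t, 0 <= g t) -> (forall t, 0 <= h t) ->
  (forall t, g (x - x * t) * h (x * t) = c * (pow01 a (1 - t) * pow01 b t)) ->
  convol g h x = x * c * convol (pow01 a) (pow01 b) 1.
Proof.
move=> x0 mg mh g0 h0 gh.
rewrite /convol (ge0_Rintegral_scale x0); last 2 first.
- exact: measurable_convol_integrand.
- by move=> t; rewrite mulr_ge0.
rewrite -mulrA -[in RHS]RintegralZl_measurable; last 2 first.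
- by [].
- by apply: measurable_convol_integrand; exact: measurable_pow01.
by congr (_ * _); apply: eq_Rintegral => t _; exact: gh.
Qed.

Lemma scaled_powers a b x t : 0 < x -> 0 < t < 1 ->
  (x - x * t) `^ (a - 1) * (x * t) `^ (b - 1) =
  x `^ (a - 1) * x `^ (b - 1) * (pow01 a (1 - t) * pow01 b t).
Proof.
move=> x0 /andP[t0 t1]; rewrite !pow01E ?t0 ?(ltW t1) ?subr_gt0 ?t1 ?lerBlDr ?lerDl ?(ltW t0)//.
rewrite -[X in X - _]mulr1 -mulrBr !powRM ?subr_ge0 ?(ltW x0) ?(ltW t0) ?(ltW t1)//.
by rewrite mulrACA.
Qed.

Lemma mulr_powR2 a b x : 0 < x ->
  x * (x `^ (a - 1) * x `^ (b - 1)) = x `^ (a + b - 1).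
Proof.
move=> x0; have xn0 : x != 0 by rewrite gt_eqF.
rewrite -powRD ?xn0 ?implybT// -{1}(powRr1 (ltW x0)) -powRD ?xn0 ?implybT//.
by congr (_ `^ _); lra.
Qed.

(** The value of the convolution at 1 is the Beta integral B(a, b), left unevaluated until
    [convol_pow01]. The bound x <= 1 keeps x t and x - x t inside the cut-off for 0 < t < 1. *)
Lemma convol_pow01_homogeneous a b x : 0 < x <= 1 ->
  convol (pow01 a) (pow01 b) x = convol (pow01 a) (pow01 b) 1 * x `^ (a + b - 1).
Proof.
move=> /andP[x0 x1].
rewrite (@convol_homogeneous a b (x `^ (a - 1) * x `^ (b - 1)) _ _ _ x0).
- by rewrite mulr_powR2// mulrC.
- exact: measurable_pow01.
- exact: measurable_pow01.
- exact: pow01_ge0.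
- exact: pow01_ge0.
move=> t; have [t01|] := boolP (0 < t < 1).
  rewrite -scaled_powers//; case/andP : t01 => t0 t1.
  have xt01 : 0 < x * t <= 1 by rewrite mulr_gt0//= (le_trans _ x1)// ler_piMr// ltW.
  have xxt01 : 0 < x - x * t <= 1.
    by rewrite subr_gt0 gtr_pMr// t1/= (le_trans _ x1)// lerBlDr lerDl ltW// mulr_gt0.
  by rewrite (pow01E a xxt01) (pow01E b xt01).
(* Outside []0, 1[] one factor vanishes on each side. *)
rewrite negb_and -!leNgt => /orP[t0|t1].
- rewrite (pow01_out _ (t := x * t)) ?(pow01_out _ (t := t)) ?mulr0//.
    by rewrite negb_and -leNgt t0.
  by rewrite negb_and -leNgt pmulr_rle0// t0.
- rewrite (pow01_out _ (t := x - x * t)) ?(pow01_out _ (t := 1 - t)) ?mul0r ?mulr0//.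
    by rewrite negb_and -leNgt subr_le0 t1.
  by rewrite negb_and -leNgt subr_le0 ler_pMr// t1.
Qed.

Lemma convol_pos_supp (g h : R -> R) x :
  (forall t, t <= 0 -> g t = 0) -> (forall t, t < 0 -> h t = 0) -> x <= 0 ->
  convol g h x = 0.
Proof.
move=> g0 h0 x0; rewrite /convol.
rewrite (_ : (fun t => _) = cst 0) ?Rintegral_cst ?mul0r//.
apply/funext => t/=; have [t0|t0] := ltP t 0; first by rewrite h0 ?mulr0.
by rewrite g0 ?mul0r// subr_le0 (le_trans x0).
Qed.

(** The exponentials multiply to exp(-x), which is constant in t, so the scaling argument for powers
    applies with the same Beta constant. *)
Lemma convol_powexp a b x :
  convol (powexp a) (powexp b) x = convol (pow01 a) (pow01 b) 1 * powexp (a + b) x.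
Proof.
have [x0|x0] := leP x 0.
  rewrite powexp_out// mulr0 convol_pos_supp//; first exact: powexp_out.
  by move=> t /ltW; exact: powexp_out.
rewrite (@convol_homogeneous a b (x `^ (a - 1) * x `^ (b - 1) * expR (- x)) _ _ _ x0).
- by rewrite powexpE// mulrA mulr_powR2// mulrC.
- exact: measurable_powexp.
- exact: measurable_powexp.
- exact: powexp_ge0.
- exact: powexp_ge0.
move=> t; have [t01|] := boolP (0 < t < 1).
  rewrite mulrAC -scaled_powers//; case/andP : t01 => t0 t1.
  rewrite !powexpE ?subr_gt0 ?gtr_pMr ?mulr_gt0//=.
  by rewrite mulrACA -expRD; congr (_ * expR _); lra.
rewrite negb_and -!leNgt => /orP[t0|t1].
- rewrite (powexp_out _ (t := x * t)) ?(pow01_out _ (t := t)) ?mulr0//.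
    by rewrite negb_and -leNgt t0.
  by rewrite pmulr_rle0.
- rewrite (powexp_out _ (t := x - x * t)) ?(pow01_out _ (t := 1 - t)) ?mul0r ?mulr0//.
    by rewrite negb_and -leNgt subr_le0 t1.
  by rewrite subr_le0 ler_pMr.
Qed.

(* Comparing total masses in [convol_powexp] evaluates the Beta integral. *)
Lemma convol_pow01 a b x : 0 < a <= 1 -> 0 < b <= 1 -> x <= 1 ->
  convol (pow01 a) (pow01 b) x =
  Gamma a * Gamma b / Gamma (a + b) * pow01 (a + b) x.
Proof.
move=> a01 b01 x1.
have Gab : Gamma a * Gamma b = convol (pow01 a) (pow01 b) 1 * Gamma (a + b).
  rewrite !GammaE -Rintegral_convol ?integrable_powexp//.
  rewrite -RintegralZl_measurable//; last exact: measurable_powexp.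
  by apply: eq_Rintegral => t _; exact: convol_powexp.
(* As a + b may exceed 1, [Gamma_gt0] does not apply; the mass identity [Gab] excludes a zero
   instead. *)
have Gab0 : Gamma (a + b) != 0.
  apply/eqP => G0; move: Gab; rewrite G0 mulr0 => /eqP.
  by apply/negP; rewrite mulf_neq0// gt_eqF// Gamma_gt0.
have -> : Gamma a * Gamma b / Gamma (a + b) = convol (pow01 a) (pow01 b) 1.
  by rewrite Gab mulfK.
have [x0|x0] := leP x 0; last by rewrite (pow01E _ (t := x)) ?x0// -convol_pow01_homogeneous ?x0.
rewrite (pow01_le0 _ x0) mulr0; apply: convol_pos_supp x0 => t t0.
  exact: pow01_le0.
exact/pow01_le0/ltW.
Qed.

End GammaBeta.

(** * Riemann-Liouville integrals on [L_1(0,1)] *)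

Section FractionalIntegral.
Context {R : realType}.
Local Notation mu := (@lebesgue_measure R).
Implicit Types (a b c x : R) (f g h : R -> R).
Local Notation L1 f := (mu.-integrable [set: R] (EFin \o f)).

Definition ext01 f : R -> R := f \_ `[0, 1].

Lemma ext01E f t : 0 <= t <= 1 -> ext01 f t = f t.
Proof. by move=> t01; rewrite /ext01 patchE mem_set//= in_itv. Qed.

Lemma ext01_out f t : ~~ (0 <= t <= 1) -> ext01 f t = 0.
Proof.
by move=> t01; rewrite /ext01 patchE memNset//= in_itv/=; exact/negP.
Qed.

Lemma ext01_lt0 f t : t < 0 -> ext01 f t = 0.
Proof. by move=> t0; apply: ext01_out; rewrite negb_and -ltNge t0. Qed.

Lemma integrable_ext01 f : L1_01 f <-> L1 (ext01 f).
Proof.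
rewrite /ext01 -restrict_EFin /L1_01/=.
by split=> ?; [exact: (integrable_mkcond _ _).1|exact: (integrable_mkcond _ _).2].
Qed.

Lemma L1_01_measurable f : L1_01 f -> measurable_fun (`[0, 1] : set R) f.
Proof. by move=> /measurable_int/measurable_EFinP. Qed.

Lemma measurable_ext01 f : L1_01 f -> measurable_fun setT (ext01 f).
Proof. by move=> /integrable_ext01; exact: L1_measurable. Qed.

Lemma ae_neq c : \forall x \ae mu, x != c.
Proof.
exists [set c]; split=> //; first exact: lebesgue_measure_set1.
by move=> x /=; move/negP; rewrite negbK => /eqP.
Qed.

Lemma ae_ext01 f g : eq01 f g -> ext01 f = ext01 g %[ae mu].
Proof.
apply: filterS => x fg _; have [x01|x01] := boolP (0 <= x <= 1).
  by rewrite !ext01E// fg//= in_itv.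
by rewrite !ext01_out.
Qed.

Lemma L1_01_ae_eq f g : L1_01 f -> measurable_fun (`[0, 1] : set R) g -> eq01 f g ->
  L1_01 g.
Proof.
move=> if_ mg fg; apply/integrableP; split; first exact/measurable_EFinP.
move/integrableP : (if_) => [mf]; apply: le_lt_trans.
rewrite le_eqVlt; apply/orP; left; apply/eqP; apply: ae_eq_integral => //.
- by apply: measurableT_comp => //; exact/measurable_EFinP.
- exact: measurableT_comp.
- by apply: filterS fg => x fg /fg /= ->.
Qed.

Lemma L1_01_lin c f g : L1_01 f -> L1_01 g -> L1_01 (fun t => c * f t + g t).
Proof.
move=> if_ ig; rewrite /L1_01/=.
exact: integrableD (integrableZl _ c if_) ig.
Qed.

Lemma L1_01_cst c : L1_01 (fun=> c).
Proof.
apply: measurable_bounded_integrable => //=.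
  by rewrite lebesgue_measure_itv/= lte_fin ltr01 ltry.
exact: bounded_cst.
Qed.

(** The point 0 must be set aside: for a = 1 the power there is 1, while [pow01] vanishes. *)
Lemma eq01_powR_pow01 a : eq01 (pow01 a) (fun t => t `^ (a - 1)).
Proof.
apply: filterS (ae_neq 0) => t t0 /=; rewrite in_itv/= => /andP[t0' t1].
by rewrite pow01E// t1 andbT lt_neqAle eq_sym t0.
Qed.

Lemma L1_01_powR a : 0 < a -> L1_01 (fun t => t `^ (a - 1)).
Proof.
move=> a0; apply: (@L1_01_ae_eq (pow01 a)).
- by apply: integrableS (integrable_pow01 a0).
- exact: measurable_funTS (measurable_powR _).
- exact: eq01_powR_pow01.
Qed.

Lemma fracI0 f : fracI 0 f = f.
Proof. by apply/funext => x; rewrite /fracI eqxx. Qed.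

Lemma fracI_convol a f x : a != 0 -> L1_01 f -> 0 <= x <= 1 ->
  fracI a f x = (Gamma a)^-1 * convol (pow01 a) (ext01 f) x.
Proof.
move=> a0 if_ /andP[x0 x1]; rewrite /fracI (negbTE a0); congr (_ * _).
(* The endpoint t = x is dropped because the kernel [pow01 a] is 0 at 0, whereas the power is 1
   there when a = 1. *)
transitivity (\int[mu]_(t in `[0, x[) ((x - t) `^ (a - 1) * f t)).
  rewrite /Rintegral integral_itv_bndo_bndc//; apply/measurable_EFinP.
  apply: measurable_funM.
    apply: (measurableT_comp (measurable_powR (a - 1))).
    exact: measurable_funB.
  apply: measurable_funS (L1_01_measurable if_) => //.
  by apply: subset_itvl; rewrite bnd_simp.
rewrite Rintegral_mkcond; apply: eq_Rintegral => t _.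
rewrite patchE; case: ifPn.
  rewrite inE/= in_itv/= => /andP[t0 tx].
  rewrite pow01E ?ext01E//; first by rewrite t0 (le_trans (ltW tx)).
  by rewrite subr_gt0 tx (le_trans _ x1)// lerBlDr lerDl.
rewrite notin_setE/= in_itv/= => /negP; rewrite negb_and -ltNge -leNgt.
move=> /orP[t0|xt]; first by rewrite ext01_lt0// mulr0.
by rewrite pow01_le0 ?mul0r// subr_le0.
Qed.

(** A kernel vanishing on t <= 0 never sees values of [h] beyond x, so cutting off at 1 is
    harmless. *)
Lemma convol_ext01 g h x : x <= 1 ->
  (forall t, t <= 0 -> g t = 0) -> (forall t, t < 0 -> h t = 0) ->
  convol g (ext01 h) x = convol g h x.
Proof.
move=> x1 g0 h0; apply: eq_Rintegral => t _.
have [t0|t0] := ltP t 0; first by rewrite ext01_lt0// h0.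
have [t1|t1] := leP t 1; first by rewrite ext01E// t0.
by rewrite g0 ?mul0r// subr_le0 (le_trans x1)// ltW.
Qed.

(** Allows [convol_pow01], which is only available up to 1, to be substituted inside a
    convolution. *)
Lemma eq_convol_le1 g g' f x : x <= 1 -> (forall t, t <= 1 -> g t = g' t) ->
  convol g (ext01 f) x = convol g' (ext01 f) x.
Proof.
move=> x1 gg'; apply: eq_Rintegral => t _.
have [t0|t0] := ltP t 0; first by rewrite ext01_lt0// !mulr0.
by rewrite gg'// (le_trans _ x1)// lerBlDr lerDl.
Qed.

Lemma convolZr g h c x : measurable_fun setT g -> measurable_fun setT h ->
  convol g (fun t => c * h t) x = c * convol g h x.
Proof.
move=> mg mh; rewrite /convol -RintegralZl_measurable//.
  by apply: eq_Rintegral => t _; rewrite mulrCA.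
exact: measurable_convol_integrand.
Qed.

Lemma convolZl g h c x : measurable_fun setT g -> measurable_fun setT h ->
  convol (fun t => c * g t) h x = c * convol g h x.
Proof.
move=> mg mh; rewrite /convol -RintegralZl_measurable//.
  by apply: eq_Rintegral => t _; rewrite mulrA.
exact: measurable_convol_integrand.
Qed.

Lemma L1_01_fracI a f : 0 <= a -> L1_01 f -> L1_01 (fracI a f).
Proof.
move=> a0 if_; have [->|an0] := eqVneq a 0; first by rewrite fracI0.
have apos : 0 < a by rewrite lt_neqAle eq_sym an0.
have iC := integrable_convol (integrable_pow01 apos) ((integrable_ext01 f).1 if_).
have iCZ := integrableZl measurableT (Gamma a)^-1 iC.
have : L1_01 (fun x => (Gamma a)^-1 * convol (pow01 a) (ext01 f) x).
  by apply: integrableS iCZ.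
apply: eq_integrable => // x; rewrite inE/= in_itv/= => x01.
by rewrite /= (fracI_convol an0 if_).
Qed.

(** Associativity of convolution, for all positive orders; both [fracIC] and [fracI_semigroup] are
    read off from this form. *)
Lemma fracI_fracI a b f : 0 < a -> 0 < b -> L1_01 f ->
  eq01 (fracI a (fracI b f)) (fun x => (Gamma a)^-1 * (Gamma b)^-1 *
    convol (convol (pow01 a) (pow01 b)) (ext01 f) x).
Proof.
move=> a0 b0 if_; have iE := (integrable_ext01 f).1 if_.
have ia := integrable_pow01 a0; have ib := integrable_pow01 b0.
apply: filterS (convolA ia ib iE) => x xA; rewrite /= in_itv/= => x01.
have an0 : a != 0 by rewrite gt_eqF.
have bn0 : b != 0 by rewrite gt_eqF.
have iB := L1_01_fracI (ltW b0) if_.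
rewrite (fracI_convol an0 iB x01) -mulrA; congr (_ * _).
pose H t := (Gamma b)^-1 * convol (pow01 b) (ext01 f) t.
have -> : ext01 (fracI b f) = ext01 H.
  apply/funext => t; have [t01|t01] := boolP (0 <= t <= 1); last by rewrite !ext01_out.
  by rewrite !ext01E// (fracI_convol bn0 if_ t01).
case/andP : (x01) => _ x1; rewrite convol_ext01//.
- rewrite /H convolZr ?xA//; first exact: measurable_pow01.
  exact: measurable_convol.
- exact: pow01_le0.
- move=> t t0; rewrite /H convol_pos_supp ?mulr0//.
  + exact: pow01_le0.
  + exact: ext01_lt0.
  + exact: ltW.
Qed.

(** From commutativity of convolution. It is used with one order equal to 1, beyond the reach of
    [fracI_semigroup]. *)
Lemma fracIC a b f : 0 < a -> 0 < b -> L1_01 f ->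
  eq01 (fracI a (fracI b f)) (fracI b (fracI a f)).
Proof.
move=> a0 b0 if_; apply: ae_eq_trans (fracI_fracI a0 b0 if_) _.
apply: ae_eq_sym; apply: ae_eq_trans (fracI_fracI b0 a0 if_) _.
rewrite (mulrC (Gamma b)^-1).
have -> : convol (pow01 b) (pow01 a) = convol (pow01 a) (pow01 b).
  by apply/funext => t; apply: convol_sym; exact: measurable_pow01.
exact: aeW.
Qed.

Lemma fracI_semigroup a b f : 0 < a -> 0 <= b -> a + b <= 1 -> L1_01 f ->
  eq01 (fracI a (fracI b f)) (fracI (a + b) f).
Proof.
move=> a0; rewrite le_eqVlt => /predU1P[<- _ if_|b0 ab1 if_].
  by rewrite fracI0 addr0; apply: aeW.
apply: ae_eq_trans (fracI_fracI a0 b0 if_) _; apply: aeW => x /=.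
rewrite in_itv/= => x01; have /andP[_ x1] := x01.
have ab0 : 0 < a + b by rewrite addr_gt0.
have a01 : 0 < a <= 1 by rewrite a0; lra.
have b01 : 0 < b <= 1 by rewrite b0; lra.
rewrite (fracI_convol _ if_ x01) ?gt_eqF//.
rewrite (eq_convol_le1 _ x1 (fun t t1 => convol_pow01 a01 b01 t1)).
rewrite convolZl; last 2 first.
- exact: measurable_pow01.
- exact: measurable_ext01.
rewrite mulrA; congr (_ * _); rewrite mulrA -invfM mulVf ?mul1r//.
by rewrite mulf_neq0// gt_eqF// Gamma_gt0.
Qed.

Lemma fracI_eq01 a f g x : 0 < a -> L1_01 f -> L1_01 g -> eq01 f g ->
  0 <= x <= 1 -> fracI a f x = fracI a g x.
Proof.
move=> a0 if_ ig fg x01; rewrite !fracI_convol ?gt_eqF//; congr (_ * _).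
apply: convol_ae_eqr (ae_ext01 fg); first exact: measurable_pow01.
- exact: measurable_ext01.
- exact: measurable_ext01.
Qed.

Lemma eq01_fracI a f g : 0 < a -> L1_01 f -> L1_01 g -> eq01 f g ->
  eq01 (fracI a f) (fracI a g).
Proof.
move=> a0 if_ ig fg; apply: aeW => x /=; rewrite in_itv/= => x01.
exact: fracI_eq01.
Qed.

Lemma fracI_lin a c f g : 0 < a -> L1_01 f -> L1_01 g ->
  eq01 (fracI a (fun t => c * f t + g t))
       (fun x => c * fracI a f x + fracI a g x).
Proof.
move=> a0 if_ ig; have ia := integrable_pow01 a0.
have iEf := (integrable_ext01 f).1 if_; have iEg := (integrable_ext01 g).1 ig.
apply: filterS2 (ae_integrable_convol ia iEf) (ae_integrable_convol ia iEg).
move=> x xf xg; rewrite /= in_itv/= => x01.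
rewrite !fracI_convol ?gt_eqF//; last exact: L1_01_lin.
rewrite mulrCA -mulrDr; congr (_ * _).
rewrite /convol -RintegralZl//.
have xcf := integrableZl measurableT c xf.
rewrite -RintegralD//; apply: eq_Rintegral => t _.
have [t01|t01] := boolP (0 <= t <= 1).
  by rewrite !ext01E// mulrDr mulrCA.
by rewrite !ext01_out// !mulr0 addr0.
Qed.

(** On [[0, 1]] the constant 1 is a.e. the kernel [pow01 1] of I^1, so both sides are the
    convolution of [pow01 a] and [pow01 1] divided by [Gamma a]. No value of Gamma at a + 1
    enters. *)
Lemma fracI_cst1 a x : 0 < a -> 0 <= x <= 1 ->
  fracI a (fun=> 1) x = fracI 1 (fun t => (Gamma a)^-1 * t `^ (a - 1)) x.
Proof.
move=> a0 x01; have iP := L1_01_powR a0.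
have iPZ : L1_01 (fun t => (Gamma a)^-1 * t `^ (a - 1)).
  exact: integrableZl _ _ iP.
rewrite !fracI_convol ?gt_eqF//; last exact: L1_01_cst.
rewrite Gamma1 invr1 mul1r.
have -> : ext01 (fun t => (Gamma a)^-1 * t `^ (a - 1)) =
    fun t => (Gamma a)^-1 * ext01 (fun t => t `^ (a - 1)) t.
  apply/funext => t; have [t01|t01] := boolP (0 <= t <= 1).
    by rewrite !ext01E.
  by rewrite !ext01_out// mulr0.
rewrite convolZr; last 2 first.
- exact: measurable_pow01.
- exact: measurable_ext01.
congr (_ * _); rewrite convol_sym; last 2 first.
- exact: measurable_pow01.
- by apply: measurable_ext01; exact: L1_01_cst.
rewrite (@convol_ae_eql _ _ (pow01 1)); last 4 first.
- by apply: measurable_ext01; exact: L1_01_cst.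
- exact: measurable_pow01.
- exact: measurable_pow01.
- apply: filterS (ae_neq 0) => t t0 _; have [t01|t01] := boolP (0 <= t <= 1).
    rewrite ext01E// pow01E ?subrr ?powRr0//.
    by rewrite lt_neqAle eq_sym t0.
  rewrite ext01_out// pow01_out//; apply: contra t01 => /andP[? ->].
  by rewrite ltW.
apply: convol_ae_eqr.
- exact: measurable_pow01.
- exact: measurable_pow01.
- exact: measurable_ext01.
- have := ae_ext01 (eq01_powR_pow01 a); apply: filterS => t /(_ I) <- _.
  have [t01|t01] := boolP (0 <= t <= 1); first by rewrite ext01E.
  rewrite ext01_out// pow01_out//; apply: contra t01 => /andP[? ->].
  by rewrite ltW.
Qed.

Lemma fracI1E f x : fracI 1 f x = \int[mu]_(t in `[0, x]) f t.
Proof.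
rewrite /fracI oner_eq0 Gamma1 invr1 mul1r; apply: eq_Rintegral => t _.
by rewrite subrr powRr0 mul1r.
Qed.

End FractionalIntegral.

(** * Injectivity of the integral of order one *)

Section Injectivity.
Context {R : realType}.
Local Notation mu := (@lebesgue_measure R).
Implicit Types (f h : R -> R) (x : R).

(** The primitive is continuous: if nonzero at x, it would be nonzero on a ball, which has positive
    measure. *)
Lemma fracI1_eq0_oo h x : L1_01 h -> eq01 (fracI 1 h) (fun=> 0) ->
  0 < x < 1 -> fracI 1 h x = 0.
Proof.
move=> ih h0 x01.
have cF : {for x, continuous (fracI 1 h)}.
  have := parameterized_integral_continuous ler01 ih.
  move=> /(continuous_within_itvP _ ltr01)[+ _ _] => /(_ x).
  rewrite in_itv/= => /(_ x01); congr continuous_at.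
  by apply/funext => y; rewrite fracI1E.
apply: contrapT => /eqP Fx0.
have Fn0 : \forall y \near x, fracI 1 h y != 0 by exact: cvgr_neq0 cF Fx0.
have In0 : \forall y \near x, y \in `]0, 1[ by apply: near_in_itvoo; rewrite in_itv.
have : nbhs x ([set y | fracI 1 h y != 0] `&` [set y | y \in `]0, 1[]) by exact: filterI.
move=> /nbhs_ballP[e /= e0 xe].
have xeN : mu.-negligible (ball x e).
  apply: negligibleS h0 => y /xe[/= Fy /subset_itv_oo_cc y01] /(_ y01) /eqP.
  exact/negP.
have : mu (ball x e) = 0%E by apply/negligibleP => //; exact: measurable_ball.
by rewrite lebesgue_measure_ball ?ltW// => /eqP; rewrite eqe mulrn_eq0/= gt_eqF.
Qed.

(** The primitive has derivative [h] almost everywhere, yet it vanishes identically on []0, 1[]. *)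
Lemma fracI1_inj0 h : L1_01 h -> eq01 (fracI 1 h) (fun=> 0) -> eq01 h (fun=> 0).
Proof.
move=> ih h0; have iE := (integrable_ext01 h).1 ih.
have locE : locally_integrable [set: R] (ext01 h) by exact: integrable_locally ih.
have intE y : mu.-integrable `[0, y] (EFin \o ext01 h) by exact: integrableS iE.
have dF := FTC1 (a := BLeft 0) intE locE.
apply: filterS2 dF (filterI (ae_neq 0) (ae_neq 1)) => x dF [x_neq0 x_neq1].
rewrite /= in_itv/= => /andP[x0 x1].
have x_gt0 : 0 < x by rewrite lt_neqAle eq_sym x_neq0.
have x_lt1 : x < 1 by rewrite lt_neqAle x_neq1.
have [//|_] := dF.
rewrite ext01E ?x0// => <-.
rewrite derive1E (near_eq_derive _ (g := cst 0)) ?derive_cst//.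
near=> y; have : y \in `]0, 1[ by near: y; apply: near_in_itvoo; rewrite in_itv/= x_gt0.
rewrite in_itv/= => y01; rewrite -[RHS](fracI1_eq0_oo ih h0 y01) fracI1E.
apply: eq_Rintegral => t; rewrite inE/= in_itv/= => /andP[t0 ty].
by rewrite ext01E// t0 (le_trans ty)//; case/andP : y01 => _ /ltW.
Unshelve. all: by end_near. Qed.

End Injectivity.

(** * Absolutely continuous representatives under fractional integration *)

Section Representatives.
Context {R : realType}.
Local Notation mu := (@lebesgue_measure R).
Implicit Types (f h F phi : R -> R) (x : R).

Lemma AC_repP h : in_AC h -> AC01 (AC_rep h) /\ eq01 h (AC_rep h).
Proof. by move=> [F hF]; exact: (xgetI (fun=> 0) hF). Qed.

Lemma ddxP h : in_AC h -> is_density (AC_rep h) (ddx h).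
Proof. by move=> /AC_repP[[phi hphi] _]; exact: (xgetI (fun=> 0) hphi). Qed.

Lemma density_fracI1 F phi x : is_density F phi -> 0 <= x <= 1 ->
  F x = F 0 + fracI 1 phi x.
Proof. by move=> [_ dF] x01; rewrite dF ?in_itv// fracI1E. Qed.

Lemma L1_01_density F phi : is_density F phi -> L1_01 F.
Proof.
move=> dF; have [iphi _] := dF.
have : L1_01 (fun x => 1 * fracI 1 phi x + F 0).
  by apply: L1_01_lin; [exact: L1_01_fracI|exact: L1_01_cst].
apply: eq_integrable => // x; rewrite inE/= in_itv/= => x01.
by rewrite /= (density_fracI1 dF x01) mul1r addrC.
Qed.

(** Apply I^a to F = F(0) + I^1 phi and bring I^1 to the outside in both terms, in preparation for
    cancelling it by injectivity. *)
Lemma fracI_density a F phi : 0 < a -> is_density F phi ->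
  eq01 (fracI a F) (fun x =>
    F 0 * fracI 1 (fun t => (Gamma a)^-1 * t `^ (a - 1)) x +
    fracI 1 (fracI a phi) x).
Proof.
move=> a0 dF; have [iphi _] := dF.
have i1 : L1_01 (fracI 1 phi) by exact: L1_01_fracI.
have : eq01 (fracI a F) (fracI a (fun x => F 0 * 1 + fracI 1 phi x)).
  apply: eq01_fracI => //; first exact: L1_01_density dF.
    by apply: L1_01_lin => //; exact: L1_01_cst.
  apply: aeW => x /=; rewrite in_itv/= => x01.
  by rewrite mulr1 (density_fracI1 dF).
move=> /ae_eq_trans; apply.
apply: ae_eq_trans (fracI_lin (F 0) a0 (L1_01_cst 1) i1) _.
have := fracIC a0 ltr01 iphi; apply: filterS => x /[swap] x01 /(_ x01) ->.
by rewrite fracI_cst1.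
Qed.

End Representatives.

(** * The projector formula *)

Theorem theorem4p1 (R : realType) (alpha gamma1 gamma2 : R)
  (alpha_gt0 : 0 < alpha) (alpha_le1 : alpha <= 1)
  (gamma1_ge0 : 0 <= gamma1) (gamma2_ge0 : 0 <= gamma2)
  (level1 : alpha + gamma1 <= 1) (level2 : alpha + gamma1 + gamma2 <= 2)
  (gamma2_lt1 : gamma2 < 1) (sum_gt1 : 1 < alpha + gamma1 + gamma2)
  (f : R -> R) (Xf : X1_2L alpha gamma1 gamma2 f) :
  let p1 := (Gamma (alpha + gamma1))^-1 *
    AC_rep (fracI gamma2 (ddx (fracI (2 - alpha - gamma1 - gamma2) f))) 0 in
  let p2 := (Gamma (alpha + gamma1 + gamma2 - 1))^-1 *
    AC_rep (fracI (2 - alpha - gamma1 - gamma2) f) 0 in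
  eq01 (P_2L alpha gamma1 gamma2 f)
    (fun x => p1 * x `^ (alpha + gamma1 - 1) +
              p2 * x `^ (alpha + gamma1 + gamma2 - 2)).
Proof.
move=> p1 p2; rewrite {}/p1 {}/p2 /P_2L /D_2L.
move: Xf => [if_]; set b := 2 - _ - _ - _.
set I1 := fracI b f; set phi1 := ddx I1; set I2 := fracI gamma2 phi1.
set phi2 := ddx I2 => acI1 acI2.
set F := AC_rep I1; set G := AC_rep I2.
set s := alpha + gamma1 in level1 level2 sum_gt1 *.
have [_ I1F] := AC_repP acI1; have [_ I2G] := AC_repP acI2.
have dF : is_density F phi1 := ddxP acI1.
have dG : is_density G phi2 := ddxP acI2.
have [iphi1 _] := dF; have [iphi2 _] := dG.
have iF := L1_01_density dF; have iG := L1_01_density dG.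
(* The order that completes [b] to 1; it is positive by [sum_gt1]. *)
pose c := s + gamma2 - 1.
have c0 : 0 < c by rewrite /c; lra.
have s0 : 0 < s by rewrite /s; lra.
have g20 : 0 < 1 - gamma2 by lra.
have cg2 : c + (1 - gamma2) = s by rewrite /c; lra.
have cb : c + b = 1 by rewrite /c /b /s; lra.
have b0 : 0 <= b by rewrite /b; move: level2; rewrite /s; lra.
pose pc (t : R) := (Gamma c)^-1 * t `^ (c - 1).
pose ps (t : R) := (Gamma s)^-1 * t `^ (s - 1).
have ipc : L1_01 pc by exact: integrableZl _ _ (L1_01_powR c0).
have ips : L1_01 ps by exact: integrableZl _ _ (L1_01_powR s0).
(* [h] is the claimed value of the projector plus I^s phi2; the goal becomes f = h almost
   everywhere. *)
pose h0 t := G 0 * ps t + fracI s phi2 t.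
pose h t := F 0 * pc t + h0 t.
have isphi2 : L1_01 (fracI s phi2) by apply: L1_01_fracI => //; exact: ltW.
have ih0 : L1_01 h0 by exact: L1_01_lin.
have ih : L1_01 h by exact: L1_01_lin.
have fh : eq01 (fracI 1 f) (fracI 1 h).
  have E1 : eq01 (fracI 1 f) (fracI c F).
    apply: ae_eq_trans (eq01_fracI c0 (L1_01_fracI b0 if_) iF I1F).
    have := fracI_semigroup c0 b0 _ if_; rewrite cb => /(_ (lexx _)).
    exact: ae_eq_sym.
  (* In the second term I^1 is commuted back inside, because [E3] rewrites I^1 phi1. *)
  have E2 : eq01 (fracI c F) (fun x => F 0 * fracI 1 pc x + fracI c (fracI 1 phi1) x).
    apply: ae_eq_trans (fracI_density c0 dF) _.
    have := fracIC c0 ltr01 iphi1.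
    by apply: filterS => x /[swap] x01 /(_ x01) ->.
  have iI2 : L1_01 I2 by exact: L1_01_fracI.
  have i1phi1 : L1_01 (fracI 1 phi1) := L1_01_fracI ler01 iphi1.
  have ig2G : L1_01 (fracI (1 - gamma2) G) := L1_01_fracI (ltW g20) iG.
  (* Split I^1 as I^(1-gamma2) I^gamma2, with positive outer order as gamma2 < 1, then replace [I2]
     by its representative. *)
  have E3' : eq01 (fracI 1 phi1) (fracI (1 - gamma2) G).
    apply: ae_eq_trans (eq01_fracI g20 iI2 iG I2G).
    have := fracI_semigroup g20 gamma2_ge0 _ iphi1; rewrite subrK => /(_ (lexx _)).
    exact: ae_eq_sym.
  have E3 : eq01 (fracI c (fracI 1 phi1)) (fracI s G).
    apply: ae_eq_trans (eq01_fracI c0 i1phi1 ig2G E3') _.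
    by have := fracI_semigroup c0 (ltW g20) _ iG; rewrite cg2; apply.
  have E4 := fracI_density s0 dG.
  have E5 := fracI_lin (F 0) ltr01 ipc ih0.
  have E6 := fracI_lin (G 0) ltr01 ips isphi2.
  apply: ae_eq_trans E1 _; apply: ae_eq_trans E2 _.
  have E34 := ae_eq_trans E3 E4.
  apply: ae_eq_sym; apply: ae_eq_trans E5 _.
  apply: filterS2 E6 E34 => x e6 e34 x01.
  by rewrite (e6 x01) (e34 x01).
have {fh} fh : eq01 f h.
  (* Injectivity is available as triviality of the kernel, hence the difference f - h, in the shape
     of [fracI_lin]. *)
  have ifh : L1_01 (fun t => - 1 * h t + f t) by exact: L1_01_lin.
  have /(_ _)/wrap[] := fracI1_inj0 ifh.
    apply: ae_eq_trans (fracI_lin (- 1) ltr01 ih if_) _.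
    by apply: filterS fh => x /[apply] ->; rewrite mulN1r addNr.
  by apply: filterS => x /[apply]; rewrite mulN1r addrC => /eqP; rewrite subr_eq0 => /eqP.
(* I^alpha D f equals I^s phi2 by the semigroup law with alpha + gamma1 <= 1, and cancels the last
   term of [h]. *)
have Dphi2 : eq01 (fracI alpha (fracI gamma1 phi2)) (fracI s phi2).
  exact: fracI_semigroup.
apply: filterS2 fh Dphi2 => x fh Dphi2 x01; rewrite (fh x01) (Dphi2 x01) /h /h0.
rewrite /pc /ps -/c; have -> : s + gamma2 - 2 = c - 1 by rewrite /c; lra.
by rewrite addrA addrK addrC; congr (_ + _); rewrite mulrCA mulrA.
Qed.
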